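(* Let $A \in \mathbb{R}^{m \times k}$ and $B \in \mathbb{R}^{k \times n}$. Then there exist $U \in \mathbb{R}^{m \times (k+1)}$ and $V \in \mathbb{R}^{(k+1) \times n}$ such that $V \geq 0$ and $UV = AB$.
   Context: $V \geq 0$ means that $V$ is component-wise nonnegative. *)

(* Defs.v *)
From mathcomp Require Import all_boot all_order all_algebra.
From mathcomp Require Import reals.

Set Implicit Arguments.
Unset Strict Implicit.
Unset Printing Implicit Defensive.

Import Order.TTheory GRing.Theory Num.Theory.
Local Open Scope ring_scope.

Definition mx_nonneg (R : realType) (p q : nat) (V : 'M[R]_(p, q)) : Prop :=
  forall (i : 'I_p) (j : 'I_q), 0 <= V i j.

(* Main.v *)
(* Adding to each column of B a multiple c of the all-ones vector 1 makes B
   nonnegative; the row c, stacked on top of B + 1 c, lets U undo the shift: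
   [-A1 | A] [c ; B + 1c] = AB. *)
Require Import Defs.
From mathcomp Require Import all_boot all_order all_algebra.
From mathcomp Require Import reals.

Import Order.TTheory GRing.Theory Num.Theory.
Local Open Scope ring_scope.

(** The shift has rank one, so a single extra row of [V] and column of [U] absorb it: [A *m (B + e
    *m c) - (A *m e) *m c = A *m B]. *)

Theorem theorem1 (R : realType) (m k n : nat)
    (A : 'M[R]_(m, k)) (B : 'M[R]_(k, n)) :
  exists (U : 'M[R]_(m, k.+1)) (V : 'M[R]_(k.+1, n)),
    mx_nonneg V /\ U *m V = A *m B.
Proof.
pose e : 'cV[R]_k := const_mx 1.
(* Column sums of absolute values bound every [- B i j] in column [j] and are themselves
   nonnegative, as the top row of [V] must be; for [k = 0] they are just 0. *)
pose c : 'rV[R]_n := \row_j \sum_i `|B i j|.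
have c_ge i j : - B i j <= c 0 j.
  rewrite mxE (bigD1 i) //= -[leLHS]addr0 lerD ?sumr_ge0 //.
  by rewrite -normrN ler_norm.
(* The size is written [1 + k], convertible to [k.+1], to expose the block structure. *)
suff Vge0 : @mx_nonneg R (1 + k) n (col_mx c (B + e *m c)).
  exists (row_mx (- (A *m e)) A : 'M_(m, 1 + k)).
  exists (col_mx c (B + e *m c)); split=> //.
  rewrite [LHS](mul_row_col (- (A *m e)) A c (B + e *m c)).
  by rewrite mulmxDr mulmxA mulNmx addrC addrK.
move=> i j; rewrite -[i]splitK; case: (split i) => i' /=.
  by rewrite col_mxEu mxE sumr_ge0.
by rewrite col_mxEd !mxE big_ord1 [e _ _]mxE mul1r -lerBlDl sub0r.
Qed.
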